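(* Let $G=(V,E)$ be a connected finite simple graph which is not $K_2$, and let $e=uv\in E$. Then $$\gamma_{st}(G)-1\leq \gamma_{st}(G-e)\leq \gamma_{st}(G)+\deg(u)+\deg(v)-2,$$ where $\deg(u)$ and $\deg(v)$ are the degrees of $u$ and $v$ in $G$.
   Context: For a finite simple graph $G$, a set $D\subseteq V(G)$ is a strong dominating set of $G$ if for every vertex $x\in V(G)\setminus D$ there is a vertex $y\in D$ with $xy\in E(G)$ and $\deg(x)\leq\deg(y)$ (degrees taken in $G$). The strong domination number $\gamma_{st}(G)$ is the minimum cardinality of a strong dominating set of $G$. $G-e$ denotes the graph obtained from $G$ by removing the edge $e$ (keeping all vertices). *)

(* Defs.v *)
From mathcomp Require Import all_boot.

Set Implicit Arguments.
Unset Strict Implicit.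
Unset Printing Implicit Defensive.

Record sgraph := SGraph {
  vertex :> finType;
  adj : rel vertex;
  adj_sym : symmetric adj;
  adj_irrefl : irreflexive adj }.

Definition deg (G : sgraph) (x : G) : nat := #|[set y | adj x y]|.

Definition connected_graph (G : sgraph) : Prop :=
  forall x y : G, connect (@adj G) x y.

Definition isomorphic (G H : sgraph) : Prop :=
  exists2 f : G -> H, bijective f & {mono f : x y / adj x y}.

Section Complete.
Variable n : nat.

Definition complete_adj : rel 'I_n := fun x y => x != y.

Lemma complete_adj_sym : symmetric complete_adj.
Proof. by move=> x y; rewrite /complete_adj eq_sym. Qed.

Lemma complete_adj_irrefl : irreflexive complete_adj.
Proof. by move=> x; rewrite /complete_adj eqxx. Qed.

Definition complete_graph : sgraph :=
  SGraph complete_adj_sym complete_adj_irrefl.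
End Complete.

Section DelEdge.
Variables (G : sgraph) (u v : G).

(* Edges are compared as unordered pairs, so both orientations of uv go. *)
Definition del_edge_adj : rel G :=
  fun x y => adj x y && ([set x; y] != [set u; v]).

Lemma del_edge_adj_sym : symmetric del_edge_adj.
Proof. by move=> x y; rewrite /del_edge_adj adj_sym setUC. Qed.

Lemma del_edge_adj_irrefl : irreflexive del_edge_adj.
Proof. by move=> x; rewrite /del_edge_adj adj_irrefl. Qed.

Definition del_edge : sgraph := SGraph del_edge_adj_sym del_edge_adj_irrefl.
End DelEdge.

Definition strong_dominating (G : sgraph) (D : {set G}) : bool :=
  [forall x, (x \notin D) ==>
     [exists y, [&& y \in D, adj x y & deg x <= deg y]]].

Lemma strong_dominating_setT (G : sgraph) : strong_dominating [set: G].
Proof. by apply/forallP => x; rewrite inE. Qed.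

(* The default [set: G] is itself strong dominating, by the lemma above, so
   the minimum is always attained by a strong dominating set. *)
Definition gamma_st (G : sgraph) : nat :=
  #|[arg min_(D < [set: G] | strong_dominating D) #|D|]|.

(* Main.v *)
Require Import Defs.
From mathcomp Require Import all_boot.
From mathcomp Require Import zify.

(** Write [H] for [G - uv].  Passing from [G] to [H] lowers the degrees of [u]
and [v] by one and changes no other degree, so a vertex other than [u] and [v]
that strongly dominates [x] in [G] still does so in [H]
([adj_del_edge_other], [deg_del_edge_mono]).

Lower bound: let [D] be a minimum strong dominating set of [H], and let [u] be
the endpoint with the larger degree in [G].  Then [u |: D] is strong dominating
in [G]: the only vertices whose degree has grown are [u], which belongs to the
set, and [v], which [u] dominates through the restored edge.

Upper bound: let [D] be a minimum strong dominating set of [G].  Only vertices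
dominated by an endpoint lying in [D] need repair
([strong_dominating_del_edge_of]).
- If no endpoint is in [D], then [D] itself works.
- If both are, it suffices to add the other neighbours of [u] and of [v], which
  are at most [(deg u - 1) + (deg v - 1)] vertices.
- If only [u] is, add [v] and the other neighbours of [u], at most [deg u]
  vertices; this fits the bound when [deg v >= 2].
- If only [u] is and [v] is a leaf, one vertex has to be saved.  As [G] is
  connected and is not [K_2], [deg u >= 2].  If some other neighbour of [u]
  has degree at least [deg u - 1], it dominates [u] in [H], so [u] can be
  dropped from the previous set
  ([strong_dominating_del_edge_swap]).  If none has, then [u] still dominates all of
  its other neighbours in [H], and adding [v] alone is enough
  ([strong_dominating_del_edge_small]). *)

Set Implicit Arguments.
Unset Strict Implicit.
Unset Printing Implicit Defensive.

(** * Strong domination *)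

Lemma strong_dominatingP (G : sgraph) (D : {set G}) :
  reflect (forall x, x \notin D ->
             exists2 y, y \in D & adj x y /\ deg x <= deg y)
          (strong_dominating D).
Proof.
apply: (iffP forallP) => domD x.
  move=> xD; have /existsP[y /and3P[yD xy le_xy]] := implyP (domD x) xD.
  by exists y.
apply/implyP=> /domD[y yD [xy le_xy]]; apply/existsP; exists y.
by rewrite yD xy le_xy.
Qed.

Lemma gamma_st_le (G : sgraph) (D : {set G}) :
  strong_dominating D -> gamma_st G <= #|D|.
Proof.
move=> domD; rewrite /gamma_st.
by case: arg_minnP => [|D0 _ minD0]; [exact: strong_dominating_setT | exact: minD0].
Qed.

Lemma gamma_st_attained (G : sgraph) :
  exists2 D : {set G}, strong_dominating D & #|D| = gamma_st G.
Proof.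
rewrite /gamma_st.
by case: arg_minnP => [|D0 domD0 _]; [exact: strong_dominating_setT | exists D0].
Qed.

(** * Degrees and adjacency after deleting an edge *)

(** The two relations are only extensionally equal, hence the transfer through
[strong_dominating] instead of an equality of graphs. *)
Lemma strong_dominating_del_edgeC (G : sgraph) (u v : G) (D : {set G}) :
  @strong_dominating (del_edge u v) D = @strong_dominating (del_edge v u) D.
Proof.
have adjC x y : @adj (del_edge u v) x y = @adj (del_edge v u) x y.
  by rewrite /= /del_edge_adj (setUC [set u]).
have degC x : @deg (del_edge u v) x = @deg (del_edge v u) x.
  by apply: eq_card => y; rewrite !inE adjC.
apply: eq_forallb => x; congr (_ ==> _).
by apply: eq_existsb => y; rewrite adjC !degC.
Qed.

Lemma gamma_st_del_edgeC (G : sgraph) (u v : G) :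
  gamma_st (del_edge u v) = gamma_st (del_edge v u).
Proof.
have le (a b : G) : gamma_st (del_edge a b) <= gamma_st (del_edge b a).
  have [D domD <-] := gamma_st_attained (del_edge b a).
  by apply: gamma_st_le; rewrite strong_dominating_del_edgeC.
by apply/eqP; rewrite eqn_leq !le.
Qed.

Section DelEdgeTheory.
Variables (G : sgraph) (u v : G).
Hypothesis uv : adj u v.
Local Notation H := (del_edge u v).

Lemma adj_neq (x y : G) : adj x y -> x != y.
Proof. by move=> xy; apply/eqP => eq_xy; rewrite eq_xy adj_irrefl in xy. Qed.

Lemma adj_del_edge_sub (x y : G) : @adj H x y -> adj x y.
Proof. by case/andP. Qed.

Lemma adj_del_edge_other (x y : G) :
  y != u -> y != v -> @adj H x y = adj x y.
Proof.
move=> yu yv; rewrite /= /del_edge_adj; case: eqP => [eq_e|_]; last by rewrite andbT.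
have: y \in [set u; v] by rewrite -eq_e set22.
by rewrite !inE (negPf yu) (negPf yv).
Qed.

Lemma adj_del_edge_endl (x : G) : x != v -> @adj H u x = adj u x.
Proof.
move=> xv; have [->|xu] := eqVneq x u; first by rewrite !adj_irrefl.
exact: adj_del_edge_other.
Qed.

(** Restates [gamma_st_le] with the cardinal taken over the vertex type of [G],
so that it can be compared with cardinals of sets of vertices of [G]. *)
Lemma gamma_st_del_edge_le_card (D : {set G}) :
  @strong_dominating H D -> gamma_st H <= #|D|.
Proof. exact: (@gamma_st_le H). Qed.

Lemma deg_del_edge_le (x : G) : @deg H x <= deg x.
Proof.
by apply: subset_leq_card; apply/subsetP => y; rewrite !inE => /adj_del_edge_sub.
Qed.

Lemma deg_del_edge_other (x : G) : x != u -> x != v -> @deg H x = deg x.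
Proof.
move=> xu xv; apply: eq_card => y.
by rewrite !inE (@adj_sym H x) (@adj_sym G x) adj_del_edge_other.
Qed.

Lemma card_nbrs_other : #|[set y | adj u y] :\ v| = (deg u).-1.
Proof. by rewrite [deg u](cardsD1 v) inE uv. Qed.

Lemma deg_del_edge_endl : @deg H u = (deg u).-1.
Proof.
rewrite -card_nbrs_other; apply: eq_card => y; rewrite !inE.
have [->|yv] := eqVneq y v; last exact: adj_del_edge_endl.
by rewrite /= /del_edge_adj eqxx andbF.
Qed.

Lemma deg_del_edge_mono (x y : G) :
  y != u -> y != v -> deg x <= deg y -> @deg H x <= @deg H y.
Proof.
move=> yu yv; rewrite (deg_del_edge_other yu yv).
exact: leq_trans (deg_del_edge_le x).
Qed.

(** * Restoring the edge *)

Lemma strong_dominating_add_edge (D : {set G}) :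
  deg v <= deg u -> @strong_dominating H D -> strong_dominating (u |: D).
Proof.
move=> le_vu /strong_dominatingP domD; apply/strong_dominatingP => x.
rewrite !inE negb_or => /andP[xu xD].
have [->|xv] := eqVneq x v; first by exists u; rewrite ?setU11 // adj_sym.
have [y yD [xy le_xy]] := domD x xD; exists y; first by rewrite inE yD orbT.
split; first exact: adj_del_edge_sub xy.
by rewrite -(deg_del_edge_other xu xv) (leq_trans le_xy) ?deg_del_edge_le.
Qed.

(** * Repairing a strong dominating set after the deletion *)

(** The common part of all the repairs: after the deletion, attention is needed
only for the vertices dropped from [D] and for those that an endpoint of the
edge dominated. *)
Lemma strong_dominating_del_edge_of (D D' : {set G}) :
    strong_dominating D -> D :\: [set u; v] \subset D' ->
    (forall x, x \notin D' ->
       x \in D \/ (exists2 y, y \in D :&: [set u; v] & adj x y /\ deg x <= deg y) ->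
       exists2 y, y \in D' & @adj H x y /\ @deg H x <= @deg H y) ->
  @strong_dominating H D'.
Proof.
move=> /strong_dominatingP domD /subsetP sDD' repair.
apply/strong_dominatingP => x xD'.
have [xD|xD] := boolP (x \in D); first by apply: repair => //; left.
have [y yD [xy le_xy]] := domD x xD.
have [yuv|yuv] := boolP (y \in [set u; v]).
  by apply: repair => //; right; exists y => //; rewrite inE yD.
exists y; first by apply: sDD'; rewrite inE yuv.
move: yuv; rewrite !inE negb_or => /andP[yu yv].
by rewrite adj_del_edge_other // deg_del_edge_mono.
Qed.

Lemma strong_dominating_del_edge_none (D : {set G}) :
  strong_dominating D -> u \notin D -> v \notin D -> @strong_dominating H D.
Proof.
move=> domD uD vD; apply: (strong_dominating_del_edge_of domD); first exact: subsetDl.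
move=> x xD [|[y]]; first by rewrite (negPf xD).
rewrite !inE => /andP[yD /orP[]/eqP eq_y]; rewrite eq_y in yD.
- by rewrite yD in uD.
- by rewrite yD in vD.
Qed.

Lemma strong_dominating_del_edge_both (D : {set G}) :
    strong_dominating D -> u \in D -> v \in D ->
  @strong_dominating H
    (D :|: (([set y | adj u y] :\ v) :|: ([set y | adj v y] :\ u))).
Proof.
move=> domD uD vD; apply: (strong_dominating_del_edge_of domD).
  exact: subset_trans (subsetDl _ _) (subsetUl _ _).
move=> x; rewrite !inE => xD' dom_x; case/negP: xD'.
have [//|xD] := boolP (x \in D).
have xu : x != u by apply: contraNneq xD => ->.
have xv : x != v by apply: contraNneq xD => ->.
case: dom_x => [|[y]]; first by rewrite (negPf xD).
rewrite xu xv !inE => /andP[_ /orP[]/eqP->] [xy _].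
- by rewrite adj_sym xy.
- by rewrite (adj_sym v) xy orbT.
Qed.

(** When no endpoint but [u] is in the set, only the neighbours of [u] can have
lost their dominator. *)
Lemma strong_dominating_del_edge_one (D : {set G}) :
    strong_dominating D -> u \in D -> v \notin D ->
  @strong_dominating H (v |: (D :|: ([set y | adj u y] :\ v))).
Proof.
move=> domD uD vD; apply: (strong_dominating_del_edge_of domD).
  by apply/subsetP => x; rewrite !inE => /andP[_ ->]; rewrite orbT.
move=> x; rewrite !inE => xD' dom_x; case/negP: xD'.
have [//|xv] := eqVneq x v; have [//|xD] := boolP (x \in D).
case: dom_x => [|[y]]; first by rewrite (negPf xD).
rewrite !inE => /andP[yD /orP[]/eqP eq_y] [xy _].
- by rewrite adj_sym -eq_y xy.
- by rewrite -eq_y yD in vD.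
Qed.

(** A neighbour of [u] whose degree is at least [deg u - 1] dominates [u] once
the edge is gone, so [u] can be traded for [v]. *)
Lemma strong_dominating_del_edge_swap (D : {set G}) (w : G) :
    strong_dominating D -> v \notin D ->
    w != v -> adj u w -> (deg u).-1 <= deg w ->
  @strong_dominating H (v |: ((D :\ u) :|: ([set y | adj u y] :\ v))).
Proof.
move=> domD vD wv uw le_uw; apply: (strong_dominating_del_edge_of domD).
  apply/subsetP => x; rewrite !inE negb_or => /andP[/andP[-> _] ->].
  by rewrite orbT.
move=> x; rewrite !inE => xD' dom_x.
have [eq_x|xu] := eqVneq x u.
  exists w; first by rewrite !inE wv uw !orbT.
  have wu : w != u by rewrite eq_sym adj_neq.
  by rewrite eq_x adj_del_edge_other // deg_del_edge_endl deg_del_edge_other.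
case/negP: xD'; rewrite xu; have [//|xv] := eqVneq x v.
have [//|xD] := boolP (x \in D); case: dom_x => [|[y]]; first by rewrite (negPf xD).
rewrite !inE => /andP[yD /orP[]/eqP eq_y] [xy _].
- by rewrite adj_sym -eq_y xy.
- by rewrite -eq_y yD in vD.
Qed.

(** If the other neighbours of [u] have degree at most [deg u - 1], then [u]
keeps dominating them in spite of its lower degree. *)
Lemma strong_dominating_del_edge_small (D : {set G}) :
    strong_dominating D -> u \in D -> v \notin D ->
    (forall x, x != v -> adj u x -> deg x <= (deg u).-1) ->
  @strong_dominating H (v |: D).
Proof.
move=> domD uD vD small; apply: (strong_dominating_del_edge_of domD).
  exact: subset_trans (subsetDl _ _) (subsetUr _ _).
move=> x; rewrite !inE negb_or => /andP[xv xD].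
case=> [|[y]]; first by rewrite (negPf xD).
rewrite !inE => /andP[yD /orP[]/eqP eq_y] [xy _]; last by rewrite -eq_y yD in vD.
rewrite eq_y adj_sym in xy; exists u; first by rewrite !inE uD orbT.
rewrite adj_sym adj_del_edge_endl // deg_del_edge_endl; split=> //.
exact: leq_trans (deg_del_edge_le x) (small x xv xy).
Qed.

(** * Bounds on the strong domination number *)

(** An edge joining two leaves is a whole connected component. *)
Lemma isolated_edge_K2 :
  connected_graph G -> deg u = 1 -> deg v = 1 -> isomorphic G (complete_graph 2).
Proof.
move=> connG deg_u deg_v.
have nbr_u y : adj u y -> y = v.
  move: deg_u => /eqP/cards1P[z eq_z]; have: v \in [set y | adj u y] by rewrite inE.
  rewrite eq_z inE => /eqP-> uy.
  by apply/eqP; rewrite -in_set1 -eq_z inE.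
have nbr_v y : adj v y -> y = u.
  move: deg_v => /eqP/cards1P[z eq_z].
  have: u \in [set y | adj v y] by rewrite inE adj_sym.
  rewrite eq_z inE => /eqP-> vy.
  by apply/eqP; rewrite -in_set1 -eq_z inE.
have vertexE x : (x == u) || (x == v).
  have stable y z : adj y z -> y \in [set u; v] -> z \in [set u; v].
    move=> yz /set2P[] eq_y; move: yz; rewrite eq_y.
    - by move/nbr_u->; rewrite set22.
    - by move/nbr_v->; rewrite set21.
  have clos : closed (@adj G) [set u; v].
    by move=> y z yz; apply/idP/idP; apply: stable; rewrite // adj_sym.
  by rewrite -in_set2 -(closed_connect clos (connG u x)) set21.
have uv_neq := adj_neq uv; have vu : adj v u by rewrite adj_sym.
pose f (x : G) : 'I_2 := if x == u then ord0 else ord_max.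
exists f.
  exists (fun i : 'I_2 => if i == ord0 then u else v) => [x|i]; rewrite /f.
    by case/orP: (vertexE x) => /eqP->; rewrite ?eqxx // (eq_sym v) (negPf uv_neq).
  have [->|i0] := eqVneq i ord0; first by rewrite eqxx.
  rewrite (eq_sym v) (negPf uv_neq); apply/val_inj.
  by case: i i0 => [[|[|]]].
move=> x y; rewrite /= /complete_adj /f.
case/orP: (vertexE x) => /eqP->; case/orP: (vertexE y) => /eqP->;
  by rewrite ?(eqxx, adj_irrefl, uv, vu, eq_sym v u, negPf uv_neq).
Qed.

Lemma gamma_st_del_edge_ge : deg v <= deg u -> gamma_st G <= (gamma_st H).+1.
Proof.
move=> le_vu; have [D domD <-] := gamma_st_attained H.
apply: leq_trans (gamma_st_le (strong_dominating_add_edge le_vu domD)) _.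
by rewrite cardsU1; case: (_ \notin _).
Qed.

Lemma gamma_st_del_edge_le_one (D : {set G}) :
    connected_graph G -> ~ isomorphic G (complete_graph 2) ->
    strong_dominating D -> u \in D -> v \notin D ->
  gamma_st H <= #|D| + deg u + deg v - 2.
Proof.
move=> connG notK2 domD uD vD.
have u_gt0 : 0 < deg u by apply/card_gt0P; exists v; rewrite inE.
have v_gt0 : 0 < deg v by apply/card_gt0P; exists u; rewrite inE adj_sym.
have cardN := card_nbrs_other.
have cardU1 (A : {set G}) : #|v |: A| <= #|A|.+1.
  by rewrite cardsU1; case: (_ \notin _).
have [v_gt1|v_le1] := ltnP 1 (deg v).
  have le := gamma_st_del_edge_le_card (strong_dominating_del_edge_one domD uD vD).
  have := cardU1 (D :|: ([set y | adj u y] :\ v)).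
  have := (leq_card_setU D ([set y | adj u y] :\ v)).1.
  rewrite cardN; lia.
have u_gt1 : 1 < deg u.
  by rewrite ltnNge; apply/negP => u_le1; apply: notK2; apply: isolated_edge_K2 => //; lia.
have [/existsP[w /and3P[wv uw le_uw]]|none] :=
    boolP [exists w, [&& w != v, adj u w & (deg u).-1 <= deg w]].
  have le := gamma_st_del_edge_le_card (strong_dominating_del_edge_swap domD vD wv uw le_uw).
  have := cardU1 ((D :\ u) :|: ([set y | adj u y] :\ v)).
  have := (leq_card_setU (D :\ u) ([set y | adj u y] :\ v)).1.
  have := cardsD1 u D; rewrite uD cardN; lia.
have small x : x != v -> adj u x -> deg x <= (deg u).-1.
  move=> xv ux; have := existsPn none x; rewrite xv ux /= -ltnNge.
  exact: ltnW.
have le := gamma_st_del_edge_le_card (strong_dominating_del_edge_small domD uD vD small).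
have := cardU1 D; lia.
Qed.

End DelEdgeTheory.

Lemma gamma_st_del_edge_le (G : sgraph) (u v : G) :
    connected_graph G -> ~ isomorphic G (complete_graph 2) -> adj u v ->
  gamma_st (del_edge u v) <= gamma_st G + deg u + deg v - 2.
Proof.
move=> connG notK2 uv; have vu : adj v u by rewrite adj_sym.
have u_gt0 : 0 < deg u by apply/card_gt0P; exists v; rewrite inE.
have v_gt0 : 0 < deg v by apply/card_gt0P; exists u; rewrite inE.
have [D domD <-] := gamma_st_attained G.
have [uD|uD] := boolP (u \in D); have [vD|vD] := boolP (v \in D).
- have := gamma_st_del_edge_le_card (strong_dominating_del_edge_both domD uD vD).
  set N := _ :|: (_ :\ u).
  have := (leq_card_setU ([set y | adj u y] :\ v) ([set y | adj v y] :\ u)).1.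
  rewrite -/N (card_nbrs_other uv) (card_nbrs_other vu).
  have := (leq_card_setU D N).1; lia.
- exact: gamma_st_del_edge_le_one.
- by rewrite gamma_st_del_edgeC addnAC; apply: gamma_st_del_edge_le_one.
- have := gamma_st_del_edge_le_card (strong_dominating_del_edge_none domD uD vD).
  lia.
Qed.

Theorem theorem2p1 (G : sgraph) (u v : G)
  (G_connected : connected_graph G)
  (G_not_K2 : ~ isomorphic G (complete_graph 2))
  (uv_edge : adj u v) :
  gamma_st G - 1 <= gamma_st (del_edge u v) <= gamma_st G + deg u + deg v - 2.
Proof.
rewrite gamma_st_del_edge_le // andbT leq_subLR add1n.
have [le_vu|/ltnW le_uv] := leqP (deg v) (deg u).
  exact: gamma_st_del_edge_ge.
by rewrite gamma_st_del_edgeC; apply: gamma_st_del_edge_ge => //; rewrite adj_sym.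
Qed.
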